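(* Let $Q,P$ be quandles such that the natural maps $Q\to G_Q$ and $P\to G_P$ are injective, and let $A,B$ be sets of representatives of orbits of $P$, $Q$ respectively. Then the free product $P*Q$ is isomorphic to $Q(G_Q*G_P,A\cup B)$, where $G_Q*G_P$ is the free product of groups and $A$, $B$ are identified with their images in $G_P\leq G_Q*G_P$ and $G_Q\leq G_Q*G_P$ under the natural maps.
   Context: A quandle is a set $Q$ with a binary operation $*$ such that: (r1) for every $x\in Q$ the map $S_x:y\mapsto y*x$ is a bijection of $Q$; (r2) $(x*y)*z=(x*z)*(y*z)$ for all $x,y,z\in Q$; (q1) $x*x=x$ for all $x\in Q$. Write $y*^{-1}x=S_x^{-1}(y)$. The maps $S_x$ are automorphisms of $Q$; orbits of $Q$ are the orbits of the action of $\mathrm{Inn}(Q)=\langle S_x\mid x\in Q\rangle$ on $Q$, and a set of representatives of orbits contains exactly one element of each orbit. The enveloping group $G_Q$ is the group with generating set $Q$ and defining relations $x*y=y^{-1}xy$ for all $x,y\in Q$; the natural map $Q\to G_Q$ sends $x$ to the corresponding generator. For a group $G$ and a subset $A\subseteq G$, the $(G,A)$-quandle $Q(G,A)$ is the quotient of the set $A\times G$ by the equivalence relation $(a,gh)\sim(a,h)$ for $a\in A$, $h\in G$, $g\in C_G(a)=\{x\in G\mid xa=ax\}$, with the (well-defined) quandle operation $[(a,u)]*[(b,v)]=[(a,uv^{-1}bv)]$. Presentations: for a set of letters $X$, let $WQ(X)$ be the set of formal words defined inductively by: $x\in WQ(X)$ for $x\in X$; if $a,b\in WQ(X)$ then $(a)*(b),(a)*^{-1}(b)\in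 WQ(X)$. For a set $R$ of formal equalities $r_i=s_i$ between words of $WQ(X)$, the quandle $\langle X\mid R\rangle$ is the quotient of $WQ(X)$ by the smallest equivalence relation $\sim$ compatible with $*$ and $*^{-1}$ such that $x\sim x*x\sim x*^{-1}x$, $x\sim(x*y)*^{-1}y\sim(x*^{-1}y)*y$, $(x*y)*z\sim(x*z)*(y*z)$ for all $x,y,z\in WQ(X)$, and $r_i\sim s_i$ for every equality in $R$. Every quandle has such a presentation. The free product of quandles $Q=\langle X\mid R\rangle$ and $P=\langle Y\mid S\rangle$ with $X\cap Y=\varnothing$ is $Q*P=\langle X\cup Y\mid R\cup S\rangle$; up to isomorphism it does not depend on the chosen presentations. *)

(* Defs.v *)
From HB Require Import structures.
From mathcomp Require Import all_boot.
From mathcomp Require Import boolp classical_sets.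

Set Implicit Arguments.
Unset Strict Implicit.
Unset Printing Implicit Defensive.

Local Open Scope quotient_scope.
Local Open Scope classical_set_scope.

Declare Scope quandle_scope.
Delimit Scope quandle_scope with Q.
Reserved Notation "x *q y" (at level 40, left associativity).
Reserved Notation "x *q^-1 y" (at level 40, left associativity).

HB.mixin Record isQuandle Q := {
  qop : Q -> Q -> Q;
  qop_bij : forall x, bijective (fun y => qop y x);
  qopD : forall x y z, qop (qop x y) z = qop (qop x z) (qop y z);
  qopxx : forall x, qop x x = x
}.

#[short(type="quandleType")]
HB.structure Definition Quandle := {Q of isQuandle Q}.

Notation "x *q y" := (qop x y) : quandle_scope.
Local Open Scope quandle_scope.

Section QuandleTheory.
Variable Q : quandleType.
Implicit Types x y : Q.

Definition qtrans x : Q -> Q := fun y => y *q x.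

Lemma qopV_subproof y x : exists z, z *q x = y.
Proof. by have [g _ gK] := qop_bij x; exists (g y). Qed.

Definition qopV y x : Q := sval (cid (qopV_subproof y x)).
Local Notation "y *q^-1 x" := (qopV y x) : quandle_scope.

Lemma qopVK x y : (y *q^-1 x) *q x = y.
Proof. exact: (svalP (cid (qopV_subproof y x))). Qed.

Lemma qopK x y : (y *q x) *q^-1 x = y.
Proof. by apply: (bij_inj (qop_bij x)); exact: qopVK. Qed.

(* Inn(Q), as the smallest set of self-maps of Q that contains every S_x and is
   closed under identity, composition and two-sided inverse. *)
Inductive Inn : (Q -> Q) -> Prop :=
| Inn_trans x : Inn (qtrans x)
| Inn_id : Inn id
| Inn_comp f g : Inn f -> Inn g -> Inn (f \o g)
| Inn_inv f g : Inn f -> cancel f g -> cancel g f -> Inn g.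

Definition qorbit x : set Q := [set f x | f in Inn].

Definition orbit_reps (A : set Q) : Prop :=
  forall x, exists! a, A a /\ qorbit x a.

End QuandleTheory.

Notation "y *q^-1 x" := (qopV y x) : quandle_scope.

Definition quandle_iso (Q P : quandleType) : Prop :=
  exists2 f : Q -> P, bijective f & {morph f : x y / x *q y >-> x *q y}.

Inductive qword (X : Type) : Type :=
| QVar of X
| QOp of qword X & qword X
| QOpV of qword X & qword X.

HB.instance Definition _ X := gen_eqMixin (qword X).
HB.instance Definition _ X := gen_choiceMixin (qword X).

Fixpoint qword_map X Y (f : X -> Y) (w : qword X) : qword Y :=
  match w with
  | QVar x => QVar (f x)
  | QOp a b => QOp (qword_map f a) (qword_map f b)
  | QOpV a b => QOpV (qword_map f a) (qword_map f b)
  end.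

Section QuandlePresentation.
Variables (X : Type) (R : set (qword X * qword X)).

Inductive qeq : qword X -> qword X -> Prop :=
| qeq_refl a : qeq a a
| qeq_sym a b : qeq a b -> qeq b a
| qeq_trans a b c : qeq a b -> qeq b c -> qeq a c
| qeq_op a a' b b' : qeq a a' -> qeq b b' -> qeq (QOp a b) (QOp a' b')
| qeq_opV a a' b b' : qeq a a' -> qeq b b' -> qeq (QOpV a b) (QOpV a' b')
| qeq_opxx a : qeq a (QOp a a)
| qeq_opVxx a : qeq a (QOpV a a)
| qeq_opK a b : qeq a (QOpV (QOp a b) b)
| qeq_opVK a b : qeq a (QOp (QOpV a b) b)
| qeq_opD a b c : qeq (QOp (QOp a b) c) (QOp (QOp a c) (QOp b c))
| qeq_rel r s : R (r, s) -> qeq r s.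

Definition qeqb : rel (qword X) := fun a b => `[< qeq a b >].

Lemma qeqb_refl : reflexive qeqb.
Proof. by move=> a; apply/asboolP; exact: qeq_refl. Qed.

Lemma qeqb_sym : symmetric qeqb.
Proof. by move=> a b; apply/asboolP/asboolP; exact: qeq_sym. Qed.

Lemma qeqb_trans : transitive qeqb.
Proof.
move=> b a c /asboolP ab /asboolP bc; apply/asboolP; exact: qeq_trans ab bc.
Qed.

Canonical qeqb_equiv := EquivRel qeqb qeqb_refl qeqb_sym qeqb_trans.

Definition qpres : Type := {eq_quot qeqb}.
HB.instance Definition _ := Quotient.on qpres.
HB.instance Definition _ := Choice.on qpres.

Lemma qpresP a b : \pi_qpres a = \pi_qpres b <-> qeq a b.
Proof.
by split=> [/(@eqmodP _ qeqb_equiv a b)/asboolP//|ab];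
   apply/(@eqmodP _ qeqb_equiv a b)/asboolP.
Qed.

Lemma qpres_repr a : qeq (repr (\pi_qpres a)) a.
Proof. by apply/qpresP; rewrite reprK. Qed.

Definition qpres_op : qpres -> qpres -> qpres := lift_op2 qpres (@QOp X).
Definition qpres_opV : qpres -> qpres -> qpres := lift_op2 qpres (@QOpV X).

Lemma pi_qpres_op a b :
  qpres_op (\pi_qpres a) (\pi_qpres b) = \pi_qpres (QOp a b).
Proof.
by rewrite /qpres_op; unlock; apply/qpresP; apply: qeq_op; exact: qpres_repr.
Qed.

Lemma pi_qpres_opV a b :
  qpres_opV (\pi_qpres a) (\pi_qpres b) = \pi_qpres (QOpV a b).
Proof.
by rewrite /qpres_opV; unlock; apply/qpresP; apply: qeq_opV; exact: qpres_repr.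
Qed.

Lemma qpres_op_bij x : bijective (fun y => qpres_op y x).
Proof.
exists (fun y => qpres_opV y x); elim/quotW: x => b; elim/quotW=> a.
- rewrite pi_qpres_op pi_qpres_opV; apply/qpresP/qeq_sym; exact: qeq_opK.
- rewrite pi_qpres_opV pi_qpres_op; apply/qpresP/qeq_sym; exact: qeq_opVK.
Qed.

Lemma qpres_opD x y z :
  qpres_op (qpres_op x y) z = qpres_op (qpres_op x z) (qpres_op y z).
Proof.
elim/quotW: x => a; elim/quotW: y => b; elim/quotW: z => c.
rewrite !pi_qpres_op; apply/qpresP; exact: qeq_opD.
Qed.

Lemma qpres_opxx x : qpres_op x x = x.
Proof.
elim/quotW: x => a; rewrite pi_qpres_op; apply/qpresP/qeq_sym; exact: qeq_opxx.
Qed.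

HB.instance Definition _ :=
  isQuandle.Build qpres qpres_op_bij qpres_opD qpres_opxx.

End QuandlePresentation.

Section EveryQuandleHasAPresentation.
Variable Q : quandleType.

Definition qtable : set (qword Q * qword Q) :=
  [set (QOp (QVar x) (QVar y), QVar (x *q y)) | x in [set: Q] & y in [set: Q]].

Fixpoint qeval (w : qword Q) : Q :=
  match w with
  | QVar x => x
  | QOp a b => qeval a *q qeval b
  | QOpV a b => qeval a *q^-1 qeval b
  end.

Lemma qeval_qeq a b : qeq qtable a b -> qeval a = qeval b.
Proof.
elim=> //=.
- by move=> ? ? ? _ -> _ ->.
- by move=> ? ? ? ? _ -> _ ->.
- by move=> ? ? ? ? _ -> _ ->.
- by move=> x; rewrite qopxx.
- by move=> x; rewrite -{2}(qopxx (qeval x)) qopK.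
- by move=> ? ?; rewrite qopK.
- by move=> ? ?; rewrite qopVK.
- by move=> ? ? ?; exact: qopD.
- by move=> r s [x _ [y _ [<- <-]]].
Qed.

Lemma qeq_qeval a : qeq qtable a (QVar (qeval a)).
Proof.
have tab x y : qeq qtable (QOp (QVar x) (QVar y)) (QVar (x *q y)).
  by apply: qeq_rel; exists x => //; exists y.
elim: a => [x|a IHa b IHb|a IHa b IHb] /=; first exact: qeq_refl.
  by apply: qeq_trans (tab _ _); exact: qeq_op.
apply: qeq_trans (qeq_opV IHa IHb) _; apply: qeq_sym.
apply: qeq_trans (qeq_opK _ _ (QVar (qeval b))) _.
by apply: qeq_opV (qeq_refl _ _); rewrite -{2}(qopVK (qeval b) (qeval a)).
Qed.

Lemma quandle_has_presentation : quandle_iso Q (qpres qtable).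
Proof.
exists (fun x => \pi_(qpres qtable) (QVar x)); last first.
  move=> x y; rewrite [RHS]pi_qpres_op; apply/qpresP/qeq_sym.
  by apply: qeq_rel; exists x => //; exists y.
exists (fun c => qeval (repr c)) => [x|].
  by rewrite (qeval_qeq (qpres_repr _ _)).
elim/quotW=> a; rewrite (qeval_qeq (qpres_repr _ _)).
by apply/qpresP/qeq_sym; exact: qeq_qeval.
Qed.

End EveryQuandleHasAPresentation.

(* The free product of <X | R> and <Y | S>; the disjoint union of the two sets
   of letters is the sum type X + Y. *)
Definition qfreeprod_rel X Y (R : set (qword X * qword X))
    (S : set (qword Y * qword Y)) : set (qword (X + Y) * qword (X + Y)) :=
  [set (qword_map inl r.1, qword_map inl r.2) | r in R] `|`
  [set (qword_map inr s.1, qword_map inr s.2) | s in S].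

Definition qfreeprod X Y (R : set (qword X * qword X))
    (S : set (qword Y * qword Y)) : quandleType :=
  qpres (qfreeprod_rel R S).

Inductive gword (X : Type) : Type :=
| GVar of X
| GOne
| GMul of gword X & gword X
| GInv of gword X.
Arguments GOne {X}.

HB.instance Definition _ X := gen_eqMixin (gword X).
HB.instance Definition _ X := gen_choiceMixin (gword X).

Section GroupPresentation.
Variables (X : Type) (R : set (gword X * gword X)).

Inductive geq : gword X -> gword X -> Prop :=
| geq_refl a : geq a a
| geq_sym a b : geq a b -> geq b a
| geq_trans a b c : geq a b -> geq b c -> geq a c
| geq_mul a a' b b' : geq a a' -> geq b b' -> geq (GMul a b) (GMul a' b')
| geq_inv a a' : geq a a' -> geq (GInv a) (GInv a')
| geq_mulA a b c : geq (GMul a (GMul b c)) (GMul (GMul a b) c)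
| geq_mul1 a : geq (GMul GOne a) a
| geq_mulr1 a : geq (GMul a GOne) a
| geq_mulV a : geq (GMul (GInv a) a) GOne
| geq_mulrV a : geq (GMul a (GInv a)) GOne
| geq_rel r s : R (r, s) -> geq r s.

Definition geqb : rel (gword X) := fun a b => `[< geq a b >].

Lemma geqb_refl : reflexive geqb.
Proof. by move=> a; apply/asboolP; exact: geq_refl. Qed.

Lemma geqb_sym : symmetric geqb.
Proof. by move=> a b; apply/asboolP/asboolP; exact: geq_sym. Qed.

Lemma geqb_trans : transitive geqb.
Proof.
move=> b a c /asboolP ab /asboolP bc; apply/asboolP; exact: geq_trans ab bc.
Qed.

Canonical geqb_equiv := EquivRel geqb geqb_refl geqb_sym geqb_trans.

Definition gpres : Type := {eq_quot geqb}.
HB.instance Definition _ := Quotient.on gpres.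
HB.instance Definition _ := Choice.on gpres.

Lemma gpresP a b : \pi_gpres a = \pi_gpres b <-> geq a b.
Proof.
by split=> [/(@eqmodP _ geqb_equiv a b)/asboolP//|ab];
   apply/(@eqmodP _ geqb_equiv a b)/asboolP.
Qed.

Lemma gpres_repr a : geq (repr (\pi_gpres a)) a.
Proof. by apply/gpresP; rewrite reprK. Qed.

Definition gpres_one : gpres := \pi_gpres GOne.
Definition gpres_mul : gpres -> gpres -> gpres := lift_op2 gpres (@GMul X).
Definition gpres_inv : gpres -> gpres := lift_op1 gpres (@GInv X).

Lemma pi_gpres_mul a b :
  gpres_mul (\pi_gpres a) (\pi_gpres b) = \pi_gpres (GMul a b).
Proof.
by rewrite /gpres_mul; unlock; apply/gpresP; apply: geq_mul; exact: gpres_repr.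
Qed.

Lemma pi_gpres_inv a : gpres_inv (\pi_gpres a) = \pi_gpres (GInv a).
Proof.
by rewrite /gpres_inv; unlock; apply/gpresP; apply: geq_inv; exact: gpres_repr.
Qed.

Lemma gpres_mulA : associative gpres_mul.
Proof.
elim/quotW=> a; elim/quotW=> b; elim/quotW=> c.
rewrite !pi_gpres_mul; apply/gpresP; exact: geq_mulA.
Qed.

Lemma gpres_mul1g : left_id gpres_one gpres_mul.
Proof.
by elim/quotW=> a; rewrite pi_gpres_mul; apply/gpresP; exact: geq_mul1.
Qed.

Lemma gpres_mulg1 : right_id gpres_one gpres_mul.
Proof.
by elim/quotW=> a; rewrite pi_gpres_mul; apply/gpresP; exact: geq_mulr1.
Qed.

Lemma gpres_mulVg : left_inverse gpres_one gpres_inv gpres_mul.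
Proof.
elim/quotW=> a; rewrite pi_gpres_inv pi_gpres_mul.
by apply/gpresP; exact: geq_mulV.
Qed.

Lemma gpres_mulgV : right_inverse gpres_one gpres_inv gpres_mul.
Proof.
elim/quotW=> a; rewrite pi_gpres_inv pi_gpres_mul.
by apply/gpresP; exact: geq_mulrV.
Qed.

HB.instance Definition _ := isGroup.Build gpres
  gpres_mulA gpres_mul1g gpres_mulg1 gpres_mulVg gpres_mulgV.

Definition gpres_gen (x : X) : gpres := \pi_gpres (GVar x).

End GroupPresentation.

Section EnvelopingGroup.
Variable Q : quandleType.

Definition envel_rel : set (gword Q * gword Q) :=
  [set (GVar (x *q y), GMul (GMul (GInv (GVar y)) (GVar x)) (GVar y))
  | x in [set: Q] & y in [set: Q]].

Definition envel : groupType := gpres envel_rel.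

Definition envel_map : Q -> envel := gpres_gen envel_rel.

End EnvelopingGroup.

(* G * H is generated by the disjoint union of G and H, subject to the
   multiplication tables of G and of H. *)
Section GroupFreeProduct.
Variables G H : groupType.

Definition gfreeprod_rel : set (gword (G + H) * gword (G + H)) :=
  [set (GMul (GVar (inl g)) (GVar (inl g')), GVar (inl (g * g')%g))
  | g in [set: G] & g' in [set: G]] `|`
  [set (GMul (GVar (inr h)) (GVar (inr h')), GVar (inr (h * h')%g))
  | h in [set: H] & h' in [set: H]].

Definition gfreeprod : groupType := gpres gfreeprod_rel.

Definition gfreeprod_inl (g : G) : gfreeprod := gpres_gen gfreeprod_rel (inl g).
Definition gfreeprod_inr (h : H) : gfreeprod := gpres_gen gfreeprod_rel (inr h).

End GroupFreeProduct.

Section GAQuandle.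
Variables (G : groupType) (A : set G).
Local Open Scope group_scope.

(* (a, k) ~ (b, h) when a = b and k = g h for some g in the centralizer of a *)
Definition gaeq (p q : A * G) : Prop :=
  p.1 = q.1 /\ exists2 g, commute g (val p.1) & p.2 = g * q.2.

Definition gaeqb : rel (A * G) := fun p q => `[< gaeq p q >].

Lemma gaeqb_refl : reflexive gaeqb.
Proof.
move=> [a u]; apply/asboolP; split=> //; exists 1; last by rewrite mul1g.
by rewrite /commute mul1g mulg1.
Qed.

Lemma gaeqb_symW p q : gaeq p q -> gaeq q p.
Proof.
case: p q => [a u] [b v] /= [/= <- [g cga ->]]; split=> //=.
exists g^-1; last by rewrite mulKg.
by apply/commute_sym/commuteV/commute_sym.
Qed.

Lemma gaeqb_sym : symmetric gaeqb.
Proof. by move=> p q; apply/asboolP/asboolP; exact: gaeqb_symW. Qed.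

Lemma gaeqb_trans : transitive gaeqb.
Proof.
move=> [b v] [a u] [c w] /asboolP[/= <- [g cga ->]] /asboolP[/= <- [h cha ->]].
apply/asboolP; split=> //=; exists (g * h); last by rewrite mulgA.
by apply/commute_sym/commuteM; exact: commute_sym.
Qed.

Canonical gaeqb_equiv := EquivRel gaeqb gaeqb_refl gaeqb_sym gaeqb_trans.

Definition gaquandle : Type := {eq_quot gaeqb}.
HB.instance Definition _ := Quotient.on gaquandle.
HB.instance Definition _ := Choice.on gaquandle.

Lemma gaquandleP p q : \pi_gaquandle p = \pi_gaquandle q <-> gaeq p q.
Proof.
by split=> [/(@eqmodP _ gaeqb_equiv p q)/asboolP//|pq];
   apply/(@eqmodP _ gaeqb_equiv p q)/asboolP.
Qed.

Lemma gaquandle_repr p : gaeq (repr (\pi_gaquandle p)) p.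
Proof. by apply/gaquandleP; rewrite reprK. Qed.

Definition ga_op (p q : A * G) : A * G :=
  (p.1, p.2 * q.2^-1 * val q.1 * q.2).

Definition gaquandle_op : gaquandle -> gaquandle -> gaquandle :=
  lift_op2 gaquandle ga_op.

Lemma ga_conjE (a g v : G) : commute g a ->
  (g * v)^-1 * (a * (g * v)) = v^-1 * (a * v).
Proof.
move=> cga; rewrite invgM -!mulgA; congr (_ * _).
by rewrite [a * _]mulgA -cga -mulgA mulKg.
Qed.

Lemma pi_gaquandle_op p q :
  gaquandle_op (\pi_gaquandle p) (\pi_gaquandle q) = \pi_gaquandle (ga_op p q).
Proof.
rewrite /gaquandle_op; unlock; apply/gaquandleP.
have [e1 [g cg eg]] := gaquandle_repr p.
have [e2 [h ch eh]] := gaquandle_repr q.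
split; first exact: e1.
exists g => //=; rewrite eg eh -!mulgA; congr (_ * (_ * _)).
by rewrite ga_conjE ?e2 // -e2.
Qed.

Lemma gaquandle_op_bij x : bijective (fun y => gaquandle_op y x).
Proof.
elim/quotW: x => -[b v].
pose opV (y : gaquandle) := \pi_gaquandle ((repr y).1, (repr y).2 * v^-1 * (val b)^-1 * v).
have opVE a u :
    opV (\pi_gaquandle (a, u)) = \pi_gaquandle (a, u * v^-1 * (val b)^-1 * v).
  apply/gaquandleP; have [/= e [g cg eg]] := gaquandle_repr (a, u).
  by split=> //; exists g => //=; rewrite eg !mulgA.
exists opV; elim/quotW=> -[a u]; rewrite ?opVE pi_gaquandle_op ?opVE /ga_op /=;
  congr (\pi_gaquandle (_, _)).
- by rewrite mulgK mulgK mulgVK.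
- by rewrite mulgK mulgVK mulgVK.
Qed.

Lemma gaquandle_opD x y z :
  gaquandle_op (gaquandle_op x y) z =
  gaquandle_op (gaquandle_op x z) (gaquandle_op y z).
Proof.
elim/quotW: x => -[a u]; elim/quotW: y => -[b v]; elim/quotW: z => -[c w].
rewrite !pi_gaquandle_op /ga_op /=; congr (\pi_gaquandle (_, _)).
by rewrite !invgM !invgK !mulgA !(mulgK, mulgVK).
Qed.

Lemma gaquandle_opxx x : gaquandle_op x x = x.
Proof.
elim/quotW: x => -[a u]; rewrite pi_gaquandle_op /ga_op /=.
by apply/gaquandleP; split=> //=; exists (val a); rewrite // mulgV mul1g.
Qed.

HB.instance Definition _ :=
  isQuandle.Build gaquandle gaquandle_op_bij gaquandle_opD gaquandle_opxx.

End GAQuandle.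

(* Main.v *)
Require Import Defs.
From HB Require Import structures.
From mathcomp Require Import all_boot.
From mathcomp Require Import boolp classical_sets.

Set Implicit Arguments.
Unset Strict Implicit.
Unset Printing Implicit Defensive.

(* Write F for the free product of P and Q, and G for the free product of their
   enveloping groups. Letting generators act by the translations S_x, G acts on
   F on the right, and the generators extend to an equivariant map e from F to
   the conjugation quandle of G with x . e(y) = x * y. Hence mapping [(e a, u)]
   to a . u gives an isomorphism from Q(G, e(D)) to F as soon as D contains
   exactly one point of every orbit, e is injective on D, and the stabilizer of
   each a in D, always contained in the centralizer of e a, is equal to it.
   For the last point no normal forms in G are needed. Take a in P; the case of
   a in Q is symmetric. The action of G lifts to F x Z/2 by toggling the second
   component each time a generator from P acts on an element of P, which gives a
   cocycle c(u, x). If u commutes with e a, then computing c((e a) u, a) and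
   c(u (e a), a) yields c(e a, a . u) = c(e a, a) = 1, so a . u lies in P. As
   e(a . u) = e a and e is injective on P, a . u = a. *)

Local Open Scope quotient_scope.
Local Open Scope classical_set_scope.
Local Open Scope quandle_scope.

(** * Quandle words, presentations and their universal property *)

Lemma qop_inj (Q : quandleType) (x : Q) : injective (fun y => y *q x).
Proof. exact: bij_inj (qop_bij x). Qed.

Lemma qmorphV (Q P : quandleType) (f : Q -> P) :
  {morph f : x y / x *q y} -> {morph f : x y / x *q^-1 y}.
Proof. by move=> fM x y; apply: (@qop_inj _ (f y)); rewrite -fM !qopVK. Qed.

Section QuandleWords.
Variables (X : Type) (T : quandleType).

Fixpoint qword_eval (v : X -> T) (w : qword X) : T :=
  match w with
  | QVar x => v x
  | QOp a b => qword_eval v a *q qword_eval v b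
  | QOpV a b => qword_eval v a *q^-1 qword_eval v b
  end.

Lemma qword_eval_qeq (v : X -> T) (R : set (qword X * qword X)) :
  (forall r s, R (r, s) -> qword_eval v r = qword_eval v s) ->
  forall a b, qeq R a b -> qword_eval v a = qword_eval v b.
Proof.
move=> vR a b; elim=> //=.
- by move=> ? ? ? _ -> _ ->.
- by move=> ? ? ? ? _ -> _ ->.
- by move=> ? ? ? ? _ -> _ ->.
- by move=> x; rewrite qopxx.
- by move=> x; rewrite -[X in X *q^-1 _](qopxx (qword_eval v x)) qopK.
- by move=> ? ?; rewrite qopK.
- by move=> ? ?; rewrite qopVK.
- by move=> ? ? ?; exact: qopD.
Qed.

End QuandleWords.

Lemma qword_eval_map X Y (T : quandleType) (f : X -> Y) (v : Y -> T) w :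
  qword_eval v (qword_map f w) = qword_eval (v \o f) w.
Proof. by elim: w => //= a -> b ->. Qed.

Section QuandlePresentationTheory.
Variables (X : Type) (R : set (qword X * qword X)).
Local Notation pi w := (\pi_(qpres R) w).

Lemma qpres_piM a b : pi (QOp a b) = pi a *q pi b.
Proof. by rewrite -pi_qpres_op. Qed.

(** The operation [*q^-1] is extracted by choice from bijectivity of translations, so it is compared
    with the class of [QOpV] by cancelling a translation. *)
Lemma qpres_piV a b : pi (QOpV a b) = pi a *q^-1 pi b.
Proof.
apply: (@qop_inj _ (pi b)); rewrite qopVK -qpres_piM; apply/qpresP/qeq_sym.
exact: qeq_opVK.
Qed.

Lemma qpres_morphE (T : quandleType) (h : qpres R -> T) :
  {morph h : x y / x *q y} ->
  forall w, h (pi w) = qword_eval (fun x => h (pi (QVar x))) w.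
Proof.
move=> hM; elim=> //= a <- b <-; first by rewrite qpres_piM hM.
by rewrite qpres_piV (qmorphV hM).
Qed.

Lemma qpres_lift (T : quandleType) (v : X -> T) :
  (forall r s, R (r, s) -> qword_eval v r = qword_eval v s) ->
  exists2 h : qpres R -> T, {morph h : x y / x *q y} &
    forall w, h (pi w) = qword_eval v w.
Proof.
move=> vR; pose h (c : qpres R) := qword_eval v (repr c).
have hE w : h (pi w) = qword_eval v w.
  exact: (qword_eval_qeq vR (qpres_repr _ _)).
exists h => //; elim/quotW=> a; elim/quotW=> b.
by rewrite -qpres_piM !hE.
Qed.

End QuandlePresentationTheory.


Lemma qpres_map X Y (R : set (qword X * qword X)) (S : set (qword Y * qword Y))
    (f : X -> Y) :
  (forall r s, R (r, s) -> S (qword_map f r, qword_map f s)) ->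
  exists2 h : qpres R -> qpres S, {morph h : x y / x *q y} &
    forall w, h (\pi_(qpres R) w) = \pi_(qpres S) (qword_map f w).
Proof.
move=> RS; pose v y := \pi_(qpres S) (QVar y).
have vE w : qword_eval (v \o f) w = \pi_(qpres S) (qword_map f w).
  by rewrite -qword_eval_map -(@qpres_morphE _ _ _ id).
have [r s rs|h hM hE] := @qpres_lift _ R _ (v \o f).
  by rewrite !vE; apply/qpresP/qeq_rel/RS.
by exists h => // w; rewrite hE vE.
Qed.

(** * The free product of quandles as a coproduct *)

Section QuandleFreeProduct.
Variables (P Q : quandleType) (X Y : Type).
Variables (R : set (qword X * qword X)) (S : set (qword Y * qword Y)).
Hypotheses (presP : quandle_iso P (qpres R)) (presQ : quandle_iso Q (qpres S)).
Local Notation F := (qfreeprod R S).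

(** The universal property, together with generation by the images of [P] and [Q], is all that the
    later argument uses of the free product; the chosen presentations disappear here. *)
Lemma qfreeprod_coproduct : exists i : P + Q -> F,
  [/\ {morph i \o inl : x y / x *q y}, {morph i \o inr : x y / x *q y},
   forall (T : quandleType) (v : P + Q -> T),
     {morph v \o inl : x y / x *q y} -> {morph v \o inr : x y / x *q y} ->
     exists2 h : F -> T, {morph h : x y / x *q y} & forall z, h (i z) = v z
   & forall K : F -> Prop, (forall z, K (i z)) ->
     (forall x y, K x -> K y -> K (x *q y)) ->
     (forall x y, K x -> K y -> K (x *q^-1 y)) -> forall x, K x].
Proof.
have [f [f' fK f'K] fM] := presP; have [g [g' gK g'K] gM] := presQ.
have f'M : {morph f' : x y / x *q y}.
  by move=> x y; rewrite -{1}(f'K x) -{1}(f'K y) -fM fK.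
have g'M : {morph g' : x y / x *q y}.
  by move=> x y; rewrite -{1}(g'K x) -{1}(g'K y) -gM gK.
have [r s rs|jl jlM jlE] := @qpres_map _ _ R (qfreeprod_rel R S) inl.
  by left; exists (r, s).
have [r s rs|jr jrM jrE] := @qpres_map _ _ S (qfreeprod_rel R S) inr.
  by right; exists (r, s).
exists (fun z => match z with inl p => jl (f p) | inr q => jr (g q) end).
split=> /=.
- by move=> x y /=; rewrite fM jlM.
- by move=> x y /=; rewrite gM jrM.
- move=> T v vl vr.
  (* A letter is evaluated at the element of [P] or [Q] that it names under the given
     isomorphism. *)
  pose vX z := match z with
    | inl x => v (inl (f' (\pi_(qpres R) (QVar x))))
    | inr y => v (inr (g' (\pi_(qpres S) (QVar y)))) end.
  have vlE w : qword_eval vX (qword_map inl w) = v (inl (f' (\pi_(qpres R) w))).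
    rewrite qword_eval_map; apply/esym.
    apply: (@qpres_morphE _ _ _ (v \o inl \o f')) => x y /=.
    by rewrite f'M; exact: vl.
  have vrE w : qword_eval vX (qword_map inr w) = v (inr (g' (\pi_(qpres S) w))).
    rewrite qword_eval_map; apply/esym.
    apply: (@qpres_morphE _ _ _ (v \o inr \o g')) => x y /=.
    by rewrite g'M; exact: vr.
  have [r s|h hM hE] := @qpres_lift _ (qfreeprod_rel R S) T vX.
    case=> -[[r' s'] /= rs [<- <-]]; rewrite ?vlE ?vrE;
      do 3 congr (_ _); by apply/qpresP/qeq_rel.
  exists h => // -[p|q].
    by rewrite -[in RHS](fK p); elim/quotW: (f p) => w; rewrite jlE hE vlE.
  by rewrite -[in RHS](gK q); elim/quotW: (g q) => w; rewrite jrE hE vrE.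
- move=> K Ki KM KV; elim/quotW; elim=> [[x|y]|a Ka b Kb|a Ka b Kb].
  + rewrite -[QVar _]/(qword_map inl (QVar x)) -jlE -[X in jl X]f'K.
    exact: (Ki (inl _)).
  + rewrite -[QVar _]/(qword_map inr (QVar y)) -jrE -[X in jr X]g'K.
    exact: (Ki (inr _)).
  + by rewrite qpres_piM; exact: KM.
  + by rewrite qpres_piV; exact: KV.
Qed.
End QuandleFreeProduct.

(** * Group presentations and their universal property *)

Local Open Scope group_scope.


Local Notation "{ 'gmorphism' G -> H }" := (UMagmaMorphism.type G H)
  (at level 0, G at level 98, H at level 99) : type_scope.

Lemma morphM_monoid (G H : groupType) (f : G -> H) :
  {morph f : x y / x * y} -> monoid_morphism f.
Proof. by move=> fM; split=> //; apply: (mulgI (f 1)); rewrite -fM !mulg1. Qed.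

Section GroupPresentationTheory.
Variables (X : Type) (R : set (gword X * gword X)).
Local Notation pi w := (\pi_(gpres R) w).

Lemma gpres_piM a b : pi (GMul a b) = pi a * pi b.
Proof. by rewrite -pi_gpres_mul. Qed.

Lemma gpres_piV a : pi (GInv a) = (pi a)^-1.
Proof. by rewrite -pi_gpres_inv. Qed.

Lemma gpres_ind (K : gpres R -> Prop) :
  (forall x, K (gpres_gen R x)) -> K 1 ->
  (forall a b, K a -> K b -> K (a * b)) -> (forall a, K a -> K a^-1) ->
  forall a, K a.
Proof.
move=> Kg K1 KM KV; elim/quotW; elim=> [x||a Ka b Kb|a Ka].
- exact: Kg.
- exact: K1.
- by rewrite gpres_piM; exact: KM.
- by rewrite gpres_piV; exact: KV.
Qed.

Variable T : groupType.

Fixpoint gword_eval (v : X -> T) (w : gword X) : T :=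
  match w with
  | GVar x => v x
  | GOne => 1
  | GMul a b => gword_eval v a * gword_eval v b
  | GInv a => (gword_eval v a)^-1
  end.

Lemma gpres_lift (v : X -> T) :
  (forall r s, R (r, s) -> gword_eval v r = gword_eval v s) ->
  exists h : {gmorphism gpres R -> T}, forall x, h (gpres_gen R x) = v x.
Proof.
move=> vR.
have veq a b : Defs.geq R a b -> gword_eval v a = gword_eval v b.
  elim=> //=.
  - by move=> ? ? ? _ -> _ ->.
  - by move=> ? ? ? ? _ -> _ ->.
  - by move=> ? ? _ ->.
  - by move=> *; rewrite mulgA.
  - by move=> *; rewrite mul1g.
  - by move=> *; rewrite mulg1.
  - by move=> *; rewrite mulVg.
  - by move=> *; rewrite mulgV.
pose h (c : gpres R) := gword_eval v (repr c).
have hE w : h (pi w) = gword_eval v w by apply: veq; exact: gpres_repr.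
have hM : {morph h : x y / x * y}.
  by elim/quotW=> a; elim/quotW=> b; rewrite -gpres_piM !hE.
pose hm := isUMagmaMorphism.Build _ _ h (morphM_monoid hM).
pose H : {gmorphism gpres R -> T} := HB.pack h hm.
by exists H => x; rewrite -[RHS]/(gword_eval v (GVar x)) -hE.
Qed.

End GroupPresentationTheory.

(** A choice of representatives becomes a function constant on orbits, a form that extends to the
    free product and there separates orbits. *)
Lemma orbit_reps_map (Q : quandleType) (A : set Q) : orbit_reps A ->
  exists2 r : Q -> Q, forall x, A x -> r x = x & forall x y, r (x *q y)%Q = r x.
Proof.
move=> repA; have [r rP] := choice repA; exists r => [x Ax|x y].
  by have [_] := rP x; apply; split=> //; exists id => //; exact: Inn_id.
apply/esym; have [_] := rP x; apply.
have [[Ar [f fInn fE]] _] := rP (x *q y)%Q; split=> //.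
by exists (f \o qtrans y) => //; exact/Inn_comp/Inn_trans.
Qed.

(** * Enveloping groups and free products of groups *)

Lemma envel_mapM (Q : quandleType) (x y : Q) :
  envel_map (x *q y)%Q = envel_map x ^ envel_map y.
Proof.
rewrite /envel_map /gpres_gen conjgE mulgA -gpres_piV -!gpres_piM.
by apply/gpresP/geq_rel; exists x => //; exists y.
Qed.

Lemma envel_lift (Q : quandleType) (T : groupType) (v : Q -> T) :
  (forall x y, v (x *q y)%Q = v x ^ v y) ->
  exists h : {gmorphism envel Q -> T}, forall x, h (envel_map x) = v x.
Proof.
move=> vM; apply: gpres_lift => r s [x _ [y _ [<- <-]]] /=.
by rewrite vM conjgE mulgA.
Qed.

Lemma gfreeprod_inlM (H K : groupType) :
  {morph @gfreeprod_inl H K : x y / x * y}.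
Proof.
move=> x y; rewrite /gfreeprod_inl /gpres_gen -gpres_piM.
apply/gpresP/geq_sym/geq_rel.
by left; exists x => //; exists y.
Qed.

Lemma gfreeprod_inrM (H K : groupType) :
  {morph @gfreeprod_inr H K : x y / x * y}.
Proof.
move=> x y; rewrite /gfreeprod_inr /gpres_gen -gpres_piM.
apply/gpresP/geq_sym/geq_rel.
by right; exists x => //; exists y.
Qed.

HB.instance Definition _ H K :=
  isUMagmaMorphism.Build _ _ (@gfreeprod_inl H K)
    (morphM_monoid (@gfreeprod_inlM H K)).
HB.instance Definition _ H K :=
  isUMagmaMorphism.Build _ _ (@gfreeprod_inr H K)
    (morphM_monoid (@gfreeprod_inrM H K)).

Lemma gfreeprod_lift (H K T : groupType) (f : {gmorphism H -> T})
    (g : {gmorphism K -> T}) :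
  exists h : {gmorphism gfreeprod H K -> T},
    (forall x, h (gfreeprod_inl K x) = f x) /\
    (forall y, h (gfreeprod_inr H y) = g y).
Proof.
pose v z := match z with inl x => f x | inr y => g y end.
have [r s|h hE] := @gpres_lift _ (@gfreeprod_rel H K) T v.
  by case=> -[x _ [y _ [<- <-]]]; rewrite /= gmulfM.
by exists h; split=> z; exact: hE.
Qed.

(** The morphism that is the identity on [H] and trivial on [K] is a retraction. *)
Lemma gfreeprod_inl_inj (H K : groupType) : injective (@gfreeprod_inl H K).
Proof.
have [h [hE _]] := gfreeprod_lift (idfun : {gmorphism H -> H})
  (one_fun H : {gmorphism K -> H}).
by apply: (can_inj (g := h)) => x; rewrite hE.
Qed.

Lemma gfreeprod_inr_inj (H K : groupType) : injective (@gfreeprod_inr H K).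
Proof.
have [h [_ hE]] := gfreeprod_lift (one_fun K : {gmorphism H -> K})
  (idfun : {gmorphism K -> K}).
by apply: (can_inj (g := h)) => x; rewrite hE.
Qed.

(** * The free product of two enveloping groups *)

Section EnvelFreeProduct.
Variables (P Q : quandleType).
Local Notation G := (gfreeprod (envel Q) (envel P)).

Definition envel_gen (z : P + Q) : G :=
  match z with
  | inl p => gfreeprod_inr (envel Q) (envel_map p)
  | inr q => gfreeprod_inl (envel P) (envel_map q)
  end.

(** The presentation of [G] takes all elements of both enveloping groups as letters, so a second
    induction inside each factor reduces them to quandle elements. *)
Lemma envel_gen_ind (K : G -> Prop) :
  (forall z, K (envel_gen z)) -> K 1 ->
  (forall a b, K a -> K b -> K (a * b)) -> (forall a, K a -> K a^-1) ->
  forall a, K a.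
Proof.
move=> Kg K1 KM KV; apply: gpres_ind => // -[] x;
  rewrite -/(gfreeprod_inl _ _) -/(gfreeprod_inr _ _).
  elim/gpres_ind: x => [q||a b Ka Kb|a Ka].
  - exact: (Kg (inr q)).
  - by rewrite -/(gfreeprod_inl _ _) gmulf1.
  - by rewrite -/(gfreeprod_inl _ _) gmulfM; exact: KM.
  - by rewrite -/(gfreeprod_inl _ _) gmulfV; exact: KV.
elim/gpres_ind: x => [p||a b Ka Kb|a Ka].
- exact: (Kg (inl p)).
- by rewrite -/(gfreeprod_inr _ _) gmulf1.
- by rewrite -/(gfreeprod_inr _ _) gmulfM; exact: KM.
- by rewrite -/(gfreeprod_inr _ _) gmulfV; exact: KV.
Qed.

Lemma envel_gen_lift (T : groupType) (v : P + Q -> T) :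
  (forall x y, v (inl (x *q y)%Q) = v (inl x) ^ v (inl y)) ->
  (forall x y, v (inr (x *q y)%Q) = v (inr x) ^ v (inr y)) ->
  exists h : {gmorphism G -> T}, forall z, h (envel_gen z) = v z.
Proof.
move=> vl vr.
have [f fE] := @envel_lift P T (v \o inl) vl.
have [g gE] := @envel_lift Q T (v \o inr) vr.
have [h [hl hr]] := gfreeprod_lift g f.
by exists h => -[p|q] /=; rewrite ?hl ?hr ?fE ?gE.
Qed.

End EnvelFreeProduct.

(** * The group of symmetries of a type, and auxiliary quandles *)

Section Symmetry.
Variable T : Type.

(** Carrying the inverse as data makes inversion a swap of fields; by [symmetryP] it adds no
    information. *)
Record symmetry := Symmetry {
  sym_fun :> T -> T;
  sym_inv : T -> T;
  sym_funK : cancel sym_fun sym_inv;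
  sym_invK : cancel sym_inv sym_fun
}.

HB.instance Definition _ := gen_eqMixin symmetry.
HB.instance Definition _ := gen_choiceMixin symmetry.

Lemma symmetryP (f g : symmetry) : f =1 g -> f = g.
Proof.
case: f g => f f' fK f'K [g g' gK g'K] /= /funext fg.
case: _ / fg in gK g'K *.
have f'g' : f' = g' by apply/funext => x; rewrite -[LHS]gK f'K.
by case: _ / f'g' in gK g'K *; congr Symmetry; exact: Prop_irrelevance.
Qed.

Definition sym_one := @Symmetry id id (frefl _) (frefl _).
(* Symmetries compose left to right, so that they act on the right. *)
Definition sym_mul (f g : symmetry) :=
  Symmetry (can_comp (@sym_funK g) (@sym_funK f))
           (can_comp (@sym_invK f) (@sym_invK g)).
Definition sym_opp (f : symmetry) := Symmetry (@sym_invK f) (@sym_funK f).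

Lemma sym_mulA : associative sym_mul.
Proof. by move=> f g h; exact: symmetryP. Qed.
Lemma sym_mul1g : left_id sym_one sym_mul.
Proof. by move=> f; exact: symmetryP. Qed.
Lemma sym_mulg1 : right_id sym_one sym_mul.
Proof. by move=> f; exact: symmetryP. Qed.
Lemma sym_mulVg : left_inverse sym_one sym_opp sym_mul.
Proof. by move=> f; apply: symmetryP; exact: sym_invK. Qed.
Lemma sym_mulgV : right_inverse sym_one sym_opp sym_mul.
Proof. by move=> f; apply: symmetryP; exact: sym_funK. Qed.

HB.instance Definition _ := isGroup.Build symmetry
  sym_mulA sym_mul1g sym_mulg1 sym_mulVg sym_mulgV.

Lemma symM (f g : symmetry) x : (f * g) x = g (f x). Proof. by []. Qed.

Lemma sym_conjP (f g h : symmetry) :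
  (forall x, h (g x) = g (f x)) -> h = f ^ g.
Proof.
move=> hgf; apply: (mulgI g); rewrite -conjgC; apply: symmetryP => x.
by rewrite !symM.
Qed.

End Symmetry.

Definition qsym (Q : quandleType) (x : Q) : symmetry Q :=
  @Symmetry Q (fun y => y *q x)%Q (fun y => y *q^-1 x)%Q (qopK x) (qopVK x).

(** With this target, the relations of an enveloping group say that its natural map is a quandle
    morphism. *)
Definition conj_quandle (G : groupType) : Type := G.
HB.instance Definition _ (G : groupType) := isQuandle.Build (conj_quandle G)
  (fun x : G => @Bijective G G (fun y => y ^ x) _ (conjgK x) (conjgKV x))
  (@conjJg G)
  (fun x : G => mulKg x x).

(** Morphisms into a trivial quandle are the functions invariant under all translations, so the
    universal property also produces invariants. *)
Definition trivial_quandle (T : Type) : Type := T.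
HB.instance Definition _ (T : Type) := @isQuandle.Build (trivial_quandle T)
  (fun x _ => x) (fun _ => Bijective (frefl _) (frefl _))
  (fun _ _ _ => erefl) (fun _ => erefl).

(** * Recognizing a quandle with a group action and an augmentation *)

Section Augmented.
Variables (F : quandleType) (G : groupType).
Variables (act : {gmorphism G -> symmetry F}) (e : F -> G).
Hypothesis eJ : forall u x, e (act u x) = e x ^ u.
Hypothesis actE : forall x y, act (e y) x = (x *q y)%Q.

Lemma gaquandle_iso (C : set G) (D : set F) :
  C = e @` D -> {in D &, injective e} ->
  (forall x u, D x -> commute u (e x) -> act u x = x) ->
  (forall y, exists x u, D x /\ y = act u x) ->
  (forall x y u, D x -> D y -> act u x = y -> x = y) ->
  quandle_iso F (gaquandle C).
Proof.
move=> eC einj stab cov orb.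
have CD x : D x -> e x \in C by move=> Dx; apply/mem_set; rewrite eC; exists x.
(* The isomorphism is built from [F] to the quotient, sending [act u x] to the class of [(e x, u)].
   Quantifying over all decompositions of [y] lets [fE] be applied to any of them. *)
have fP y : exists c : gaquandle C, forall x (Dx : D x) u, y = act u x ->
    c = \pi_(gaquandle C) (exist _ (e x) (CD x Dx), u).
  have [x [u [Dx ->]]] := cov y.
  exists (\pi_(gaquandle C) (exist _ (e x) (CD x Dx), u)) => x' Dx' u' uu'.
  have xx' : x = x'.
    by apply: (orb _ _ (u * u'^-1)) => //;
      rewrite gmulfM symM uu' -symM -gmulfM mulgV gmulf1.
  case: _ / xx' in Dx' uu' *.
  apply/gaquandleP; split => /=; first exact: val_inj.
  exists (u * u'^-1); last by rewrite mulgVK.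
  (* The element [u * u'^-1] fixes [x], so by equivariance of [e] conjugation by it fixes [e x]. *)
  apply: (mulgI (u * u'^-1)^-1); rewrite mulKg -conjgE -eJ.
  by rewrite gmulfM symM uu' -symM -gmulfM mulgV gmulf1.
have {fP} [f fE] := choice fP.
have fM : {morph f : x y / (x *q y)%Q}.
  move=> y y'; have [x [u [Dx yE]]] := cov y.
  have [x' [u' [Dx' yE']]] := cov y'.
  rewrite (fE _ _ Dx _ yE) (fE _ _ Dx' _ yE') [RHS]pi_gaquandle_op /ga_op /=.
  (* By equivariance [u'^-1 * e x' * u'] is [e y'], which acts as translation by [y']. *)
  by apply: fE; rewrite -!mulgA -conjgE -eJ -yE' gmulfM symM -yE actE.
exists f => //.
have finj : injective f.
  move=> y y'; have [x [u [Dx yE]]] := cov y.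
  have [x' [u' [Dx' yE']]] := cov y'.
  rewrite (fE _ _ Dx _ yE) (fE _ _ Dx' _ yE').
  move=> /gaquandleP[/= [exx'] [h hx uE]].
  have xx' : x = x' by apply: einj => //; exact: mem_set.
  by rewrite yE yE' uE gmulfM symM (stab _ h) // xx'.
have fsurj c : exists y, f y = c.
  elim/quotW: c => -[[c Cc] u]; have := Cc; rewrite inE {1}eC => -[x Dx ex].
  exists (act u x); rewrite (fE _ _ Dx u) //.
  by congr (\pi_(gaquandle C) (_, _)); exact: val_inj.
have {fsurj} [g gK] := choice fsurj.
by exists g => // y; apply: finj; rewrite gK.
Qed.

End Augmented.

(** * The action and the augmentation on the coproduct *)

Section Coproduct.
Variables (P Q F : quandleType) (i : P + Q -> F).
Hypothesis il : forall x y, i (inl (x *q y)%Q) = (i (inl x) *q i (inl y))%Q.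
Hypothesis ir : forall x y, i (inr (x *q y)%Q) = (i (inr x) *q i (inr y))%Q.
Hypothesis i_lift : forall (T : quandleType) (v : P + Q -> T),
  {morph v \o inl : x y / (x *q y)%Q} -> {morph v \o inr : x y / (x *q y)%Q} ->
  exists2 h : F -> T, {morph h : x y / (x *q y)%Q} & forall z, h (i z) = v z.
Hypothesis i_ind : forall K : F -> Prop, (forall z, K (i z)) ->
  (forall x y, K x -> K y -> K (x *q y)%Q) ->
  (forall x y, K x -> K y -> K (x *q^-1 y)%Q) -> forall x, K x.

Local Notation G := (gfreeprod (envel Q) (envel P)).
Local Notation gen := (@envel_gen P Q).

Lemma gen_inlM (x y : P) : gen (inl (x *q y)%Q) = gen (inl x) ^ gen (inl y).
Proof. by rewrite /= envel_mapM gmulfJ. Qed.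

Lemma gen_inrM (x y : Q) : gen (inr (x *q y)%Q) = gen (inr x) ^ gen (inr y).
Proof. by rewrite /= envel_mapM gmulfJ. Qed.

Lemma coproduct_invariant (T : Type) (v : P + Q -> T) :
  (forall x y, v (inl (x *q y)%Q) = v (inl x)) ->
  (forall x y, v (inr (x *q y)%Q) = v (inr x)) ->
  exists2 f : F -> T, forall x y, f (x *q y)%Q = f x & forall z, f (i z) = v z.
Proof. by move=> vl vr; exact: (@i_lift (trivial_quandle T)). Qed.

(** Right distributivity says that the translation by [x * y] is the conjugate of the translation by
    [x] under that by [y], which is the defining relation of the enveloping group. *)
Lemma coproduct_action : exists act : {gmorphism G -> symmetry F},
  forall z x, act (gen z) x = (x *q i z)%Q.
Proof.
have [||act actE] := @envel_gen_lift P Q (symmetry F) (@qsym F \o i).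
- by move=> x y; apply: sym_conjP => w /=; rewrite il -qopD.
- by move=> x y; apply: sym_conjP => w /=; rewrite ir -qopD.
by exists act => z x; rewrite actE.
Qed.

Lemma coproduct_augmentation : exists2 e : F -> G,
  forall x y, e (x *q y)%Q = e x ^ e y & forall z, e (i z) = gen z.
Proof.
by apply: (@i_lift (conj_quandle G)); [exact: gen_inlM | exact: gen_inrM].
Qed.

Variables (act : {gmorphism G -> symmetry F}) (e : F -> G).
Hypothesis act_gen : forall z x, act (gen z) x = (x *q i z)%Q.
Hypothesis eM : forall x y, e (x *q y)%Q = e x ^ e y.
Hypothesis e_i : forall z, e (i z) = gen z.

Lemma act_mul u v x : act (u * v) x = act v (act u x).
Proof. by rewrite gmulfM. Qed.

Lemma act1 x : act 1 x = x.
Proof. by rewrite gmulf1. Qed.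

Lemma actK u : cancel (act u) (act u^-1).
Proof. by move=> x; rewrite -act_mul mulgV act1. Qed.

Lemma actKV u : cancel (act u^-1) (act u).
Proof. by move=> x; rewrite -act_mul mulVg act1. Qed.

Lemma augmentation_actJ u x : e (act u x) = e x ^ u.
Proof.
elim/envel_gen_ind: u x => [z|| u v IHu IHv | u IHu] x.
- by rewrite act_gen eM e_i.
- by rewrite act1 conjg1.
- by rewrite act_mul IHv IHu conjgM.
- by rewrite -{2}(actKV u x) IHu conjgK.
Qed.

Lemma act_augmentation x y : act (e y) x = (x *q y)%Q.
Proof.
elim/i_ind: y x => [z|y z IHy IHz|y z IHy IHz] x.
- by rewrite e_i act_gen.
- by rewrite eM conjgE !act_mul IHz IHy -{2}(actKV (e z) x) IHz qopD.
- have -> : e (y *q^-1 z)%Q = e y ^ (e z)^-1.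
    by rewrite -{2}(qopVK z y) eM conjgK.
  rewrite conjgE invgK !act_mul IHz IHy.
  by apply: (can_inj (actK (e z))); rewrite actKV IHz [RHS]qopD qopVK.
Qed.

Lemma act_invariant (T : Type) (f : F -> T) :
  (forall x y, f (x *q y)%Q = f x) -> forall u x, f (act u x) = f x.
Proof.
move=> fM; elim/envel_gen_ind=> [z|| u v IHu IHv | u IHu] x.
- by rewrite act_gen fM.
- by rewrite act1.
- by rewrite act_mul IHv.
- by rewrite -{2}(actKV u x) IHu.
Qed.

(** Applied to the two inclusions [j], this carries orbits of [P] and [Q] into orbits of [G] on
    [F]. *)
Lemma act_Inn (Q' : quandleType) (j : Q' -> F) (k : Q' -> P + Q) :
  (forall x y, j (x *q y)%Q = (j x *q i (k y))%Q) ->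
  forall f, Inn f -> forall x, exists u, j (f x) = act u (j x).
Proof.
move=> jM f; elim=> {f} [y|| f g _ IHf _ IHg | f g _ IHf fK gK] x.
- by exists (gen (k y)); rewrite act_gen -jM.
- by exists 1; rewrite act1.
- have [u uE] := IHg x; have [v vE] := IHf (g x).
  by exists (u * v); rewrite act_mul -uE.
- have [u uE] := IHf (g x); exists u^-1.
  by rewrite -{2}(gK x) uE actK.
Qed.

(** * The images of the two summands and a cocycle modulo 2 *)

Definition summand (b : bool) : set F :=
  [set i z | z in [set z | b = is_inl z]].

Lemma summand_qop z x :
  summand (is_inl z) (x *q i z)%Q <-> summand (is_inl z) x.
Proof.
split=> -[]; case: z => z [] z' //= _.
- move=> zx; exists (inl (z' *q^-1 z)%Q) => //.
  by apply: (@qop_inj _ (i (inl z))); rewrite -il /= qopVK.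
- move=> zx; exists (inr (z' *q^-1 z)%Q) => //.
  by apply: (@qop_inj _ (i (inr z))); rewrite -ir /= qopVK.
- by move=> <-; exists (inl (z' *q z)%Q) => //; exact: il.
- by move=> <-; exists (inr (z' *q z)%Q) => //; exact: ir.
Qed.

(** The boolean [b] selects the toggling summand, [true] for [P] and [false] for [Q], so one
    construction serves both cases. *)
Lemma summand_cocycle (b : bool) : exists c : G -> F -> bool,
  (forall (z : P + Q) x, c (gen z) x = (is_inl z == b) && `[< summand b x >]) /\
  forall u v x, c (u * v) x = c u x (+) c v (act u x).
Proof.
pose d (z : P + Q) x := (is_inl z == b) && `[< summand b x >].
(* Moving a point by a generator of the same summand as [z] leaves its toggle unchanged. As [d z]
   depends only on the summand of [z], both sides of each enveloping relation then toggle
   equally. *)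
have dM (z z' : P + Q) x : is_inl z = is_inl z' :> bool ->
    d z (x *q i z')%Q = d z x.
  rewrite /d => ->; case: eqP => //= <-.
  exact: asbool_equiv_eq (summand_qop _ _).
pose f z (s : F * bool) := ((s.1 *q i z)%Q, s.2 (+) d z s.1).
pose g z (s : F * bool) := ((s.1 *q^-1 i z)%Q, s.2 (+) d z (s.1 *q^-1 i z)%Q).
have fK z : cancel (f z) (g z) by move=> [x n]; rewrite /f /g /= qopK addbK.
have gK z : cancel (g z) (f z) by move=> [x n]; rewrite /f /g /= qopVK addbK.
have [||h hE] := @envel_gen_lift P Q _ (fun z => Symmetry (fK z) (gK z)).
- move=> x y; apply: sym_conjP => -[w n]; rewrite /= /f /= !dM //.
  by rewrite il -qopD; congr pair; rewrite -!addbA; congr addb; rewrite addbC.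
- move=> x y; apply: sym_conjP => -[w n]; rewrite /= /f /= !dM //.
  by rewrite ir -qopD; congr pair; rewrite -!addbA; congr addb; rewrite addbC.
(* Each [u] acts over [act u] by a shift of the bit that depends only on the point; this shift is
   the cocycle. *)
have /choice[c cE] u : exists c : F -> bool,
    forall x n, h u (x, n) = (act u x, n (+) c x).
  elim/envel_gen_ind: u => [z|| u v [c cE] [c' c'E] | u [c cE]].
  - by exists (d z) => x n; rewrite hE act_gen.
  - by exists (fun=> false) => x n; rewrite gmulf1 act1 addbF.
  - exists (fun x => c x (+) c' (act u x)) => x n.
    by rewrite gmulfM symM cE c'E act_mul addbA.
  (* A shift modulo 2 is its own inverse, so [u^-1] at [x] repeats the shift that [u] makes at
     [act u^-1 x]. *)
  - exists (fun x => c (act u^-1 x)) => x n.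
    apply: (can_inj (sym_funK (h u))).
    by rewrite -symM -gmulfM mulVg gmulf1 cE actKV addbK.
exists c; split=> [z x|u v x].
  by have := cE (gen z) x false; rewrite hE /= /f /= act_gen => -[].
by have := cE (u * v) x false; rewrite gmulfM symM !cE => -[].
Qed.

Hypothesis injP : injective (@envel_map P).
Hypothesis injQ : injective (@envel_map Q).

(** Generators of different summands are told apart by the cocycle: [gen z] toggles at [i z],
    whereas a generator of the other summand never does. Within one summand the injectivity
    hypotheses apply. *)
Lemma gen_inj : injective gen.
Proof.
move=> z z' zz'; have [c [cE _]] := summand_cocycle (is_inl z).
have : c (gen z') (i z) = true.
  by rewrite -zz' cE eqxx; apply/asboolP; exists z.
rewrite cE => /andP[/eqP + _].
case: z z' zz' {c cE} => [p|q] [p'|q'] //= zz' _; congr (_ _).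
- exact/injP/(@gfreeprod_inr_inj (envel Q)).
- exact/injQ/(@gfreeprod_inl_inj _ (envel P)).
Qed.

Lemma stabilizer_centralizer z u : commute u (gen z) -> act u (i z) = i z.
Proof.
move=> uz; have [c [cE cM]] := summand_cocycle (is_inl z).
have zS : summand (is_inl z) (i z) by exists z.
have : c (gen z) (act u (i z)) = true.
  (* Both expansions contain [c u (i z)], since [gen z] fixes [i z] by idempotence; cancelling it
     leaves the claim. *)
  have := cM u (gen z) (i z); rewrite [u * _]uz cM act_gen qopxx.
  rewrite [c (gen z) (i z)]cE eqxx (asboolT zS) addbC.
  by move=> /addbI <-.
rewrite cE => /andP[_ /asboolP[z' _ z'E]]; rewrite -z'E; congr i.
apply: gen_inj; rewrite -e_i z'E augmentation_actJ e_i.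
by rewrite conjgE -uz mulKg.
Qed.

(** * Orbit representatives in the coproduct *)

Variables (A : set P) (B : set Q).
Hypotheses (repA : orbit_reps A) (repB : orbit_reps B).

Definition coproduct_reps : set F :=
  (i \o inl) @` A `|` (i \o inr) @` B.

Lemma coproduct_repsP x : coproduct_reps x ->
  exists2 z, x = i z & match z with inl p => A p | inr q => B q end.
Proof. by case=> -[z Az <-]; [exists (inl z) | exists (inr z)]. Qed.

Lemma coproduct_reps_cover y : exists x u, coproduct_reps x /\ y = act u x.
Proof.
(* For a product only the left operand has to be decomposed, because the right operand [y] acts
   through [e y]. *)
elim/i_ind: y => [[p|q]|_ y [x [u [Dx ->]]] _|_ y [x [u [Dx ->]]] _].
- have [a [[Aa [f /act_Inn fInn fE]] _]] := repA p.
  have [|u uE] := fInn (i \o inl) inl _ p; first exact: il.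
  exists (i (inl a)), u^-1; split; first by left; exists a.
  by rewrite -fE -[RHS]/(act _ ((i \o inl) (f p))) uE actK.
- have [b [[Bb [f /act_Inn fInn fE]] _]] := repB q.
  have [|u uE] := fInn (i \o inr) inr _ q; first exact: ir.
  exists (i (inr b)), u^-1; split; first by right; exists b.
  by rewrite -fE -[RHS]/(act _ ((i \o inr) (f q))) uE actK.
- by exists x, (u * e y); rewrite act_mul act_augmentation.
- exists x, (u * (e y)^-1); split=> //; rewrite act_mul.
  by apply: (can_inj (actK (e y))); rewrite actKV act_augmentation qopVK.
Qed.

(** The maps to representatives on [P] and [Q] are invariant, so they extend to an invariant
    function on [F]. With values taken in [F] itself, that function fixes every representative, and
    two representatives in one orbit coincide. *)
Lemma coproduct_reps_orbit x y u :
  coproduct_reps x -> coproduct_reps y -> act u x = y -> x = y.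
Proof.
have [a aA aM] := orbit_reps_map repA.
have [b bB bM] := orbit_reps_map repB.
pose v z := match z with inl p => i (inl (a p)) | inr q => i (inr (b q)) end.
have [||f fM fE] := @coproduct_invariant _ v.
- by move=> ? ?; rewrite /= aM.
- by move=> ? ?; rewrite /= bM.
have fD w : coproduct_reps w -> f w = w.
  by move=> /coproduct_repsP[[p|q] -> ?]; rewrite fE /= ?aA ?bB.
by move=> /fD E1 /fD E2 E3; rewrite -E1 -E2 -E3 (act_invariant fM).
Qed.

Lemma coproduct_gaquandle : quandle_iso F
  (gaquandle ((gen \o inl) @` A `|` (gen \o inr) @` B)).
Proof.
apply: (@gaquandle_iso _ _ act e augmentation_actJ act_augmentation _
          coproduct_reps).
- rewrite /coproduct_reps image_setU !image_comp.
  by congr (_ `|` _); apply: eq_imagel => z _ /=; rewrite e_i.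
- move=> _ _ /set_mem/coproduct_repsP[z -> _] /set_mem/coproduct_repsP[z' -> _].
  by rewrite !e_i => /gen_inj ->.
- move=> _ u /coproduct_repsP[z -> _]; rewrite e_i.
  exact: stabilizer_centralizer.
- exact: coproduct_reps_cover.
- exact: coproduct_reps_orbit.
Qed.

End Coproduct.

Theorem theorem7p2 (Q P : quandleType)
    (injQ : injective (@envel_map Q)) (injP : injective (@envel_map P))
    (A : set P) (B : set Q) (repA : orbit_reps A) (repB : orbit_reps B)
    (X Y : Type) (R : set (qword X * qword X)) (S : set (qword Y * qword Y))
    (presP : quandle_iso P (qpres R)) (presQ : quandle_iso Q (qpres S)) :
  let G := gfreeprod (envel Q) (envel P) in
  let A' : set G := [set gfreeprod_inr (envel Q) (envel_map a) | a in A] in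
  let B' : set G := [set gfreeprod_inl (envel P) (envel_map b) | b in B] in
  quandle_iso (qfreeprod R S) (gaquandle (A' `|` B')).
Proof.
have [i [il ir i_lift i_ind]] := qfreeprod_coproduct presP presQ.
have [act actE] := coproduct_action il ir.
have [e eM e_i] := coproduct_augmentation i_lift.
exact: (coproduct_gaquandle il ir i_lift i_ind actE eM e_i).
Qed.
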